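(* Let $q$ be a prime power and $n\ge1$ an integer. There is no transitive affine transformation of $\mathbb{F}_q^n$ unless either $n=1$ and $q$ is prime, or $n=2$ and $q=2$. In both of these cases transitive affine transformations of $\mathbb{F}_q^n$ exist.
   Context: A map $f:\mathbb{F}_q^n\to\mathbb{F}_q^n$ is affine if there exist $A\in\mathrm{GL}_n(\mathbb{F}_q)$ and $b\in\mathbb{F}_q^n$ such that $f(x)=Ax+b$ for all $x\in\mathbb{F}_q^n$. A map $f:X\to X$ is transitive if for any $x,y\in X$ there is an integer $i\ge0$ with $y=f^i(x)$. *)

(* Defs.v *)
From HB Require Import structures.
From mathcomp Require Import all_boot all_order all_algebra.

Set Implicit Arguments.
Unset Strict Implicit.
Unset Printing Implicit Defensive.

Import GRing.Theory.
Local Open Scope ring_scope.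

(* Invertibility is expressed by [unitmx] rather than ['GL_n[F]], whose
   elements have the type ['M[F]_n.-1.+1] and do not act directly on ['cV[F]_n]. *)
Definition affine_map (F : finFieldType) (n : nat)
    (f : 'cV[F]_n -> 'cV[F]_n) : Prop :=
  exists (A : 'M[F]_n) (b : 'cV[F]_n),
    A \in unitmx /\ forall x, f x = A *m x + b.

Definition transitive_map (X : Type) (f : X -> X) : Prop :=
  forall x y : X, exists i : nat, y = iter i f x.

(* Main.v *)
Require Import Defs.
From HB Require Import structures.
From mathcomp Require Import all_boot all_order all_algebra.
From mathcomp Require Import finfield.

Set Implicit Arguments.
Unset Strict Implicit.
Unset Printing Implicit Defensive.

Import GRing.Theory.
Local Open Scope ring_scope.

(** Let [N = #|F| ^ n] and let [f x = A x + b] be transitive. A transitive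
    injection of an [N]-element set is a single [N]-cycle, so [f] iterated [N]
    times is the identity, whence [A ^ N = 1]. As [N] is a power of the
    characteristic [p], this reads [(A - 1) ^ N = 0]: the matrix [A] is
    unipotent, so [(A - 1) ^ n = 0] already ([unipotent_exp_dim]).

    On the other hand [f] iterated [m] times sends [0] to
    [(1 + A + ... + A ^ (m - 1)) b], and for [m = p ^ s] the geometric sum is
    [(A - 1) ^ (m - 1)] ([geometric_sum_pchar]). As soon as [p ^ s > n] it
    vanishes, so the orbit of [0] closes up after at most [p ^ s] steps, and
    therefore [N <= p ^ s]. The least such power is at most [p * n], giving
    [#|F| ^ n <= p * n] ([transitive_affine_bound]), which leaves only
    [n = 1] with [#|F| = p], and [n = 2] with [#|F| = 2]
    ([expn_le_pmul_cases]).

    Conversely, translation by [1] is transitive on a field with a prime number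
    of elements, and on the plane over the two-element field the map
    [(u, v) |-> (u + v, v + 1)] runs through all four points. *)

(** * Transitive maps of finite types *)

Section TransitiveMap.

Variables (T : finType) (f : T -> T).
Hypothesis f_trans : transitive_map f.

Lemma transitive_map_iter_card x : injective f -> iter #|T| f x = x.
Proof.
move=> f_inj; rewrite -[RHS](iter_order f_inj); congr (iter _ f x).
apply: eq_card => y; have [i ->] := f_trans x y.
by rewrite /= [RHS]fconnect_iter.
Qed.

Lemma transitive_map_card_le x m :
  (0 < m)%N -> iter m f x = x -> (#|T| <= m)%N.
Proof.
move=> m_gt0 fmx; rewrite -(size_traject f x m).
apply: leq_trans (card_size _); apply/subset_leq_card/subsetP => y _.
have [i ->] := f_trans x y.
suff/loopingP : looping f x m by apply.
by rewrite /looping fmx; case: m m_gt0 {fmx} => // m _; rewrite mem_head.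
Qed.

End TransitiveMap.

(** * Powers of [x - 1] in positive characteristic *)

Lemma exprB1_pchar (R : comNzRingType) (x : R) m :
  [pchar R].-nat m -> (x - 1) ^+ m = x ^+ m - 1.
Proof.
by move/(exprDn_pchar (x - 1) 1); rewrite subrK expr1n => ->; rewrite addrK.
Qed.

(** Both sides become [x ^ m - 1] after multiplication by [x - 1]; working with
    the indeterminate allows cancelling that factor, which a matrix would not. *)
Lemma geometric_sum_pchar (F : fieldType) m :
  (0 < m)%N -> [pchar F].-nat m ->
  \sum_(i < m) 'X^i = ('X - 1) ^+ m.-1 :> {poly F}.
Proof.
move=> m_gt0 charm; have X1_neq0 : 'X - 1 != 0 :> {poly F}.
  by rewrite -polyC1 polyXsubC_eq0.
apply: (mulfI X1_neq0); rewrite -subrX1 -exprS prednK //.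
by rewrite exprB1_pchar // (eq_pnat _ (pchar_poly F)).
Qed.

(** The minimal polynomial divides a power of ['X - 1] and has degree at most
    the dimension, so it divides ['X - 1] to the dimension. *)
Lemma unipotent_exp_dim (F : fieldType) n (A : 'M[F]_n.+1) N :
  (A - 1) ^+ N = 0 -> (A - 1) ^+ n.+1 = 0.
Proof.
have hornerX1 k : (A - 1) ^+ k = horner_mx A (('X - 1%:P) ^+ k).
  by rewrite rmorphXn rmorphB /= horner_mx_X horner_mx_C.
rewrite !hornerX1 => /mxminpoly_min/dvdp_exp_XsubCP[k _ minA].
have k_le : (k <= n.+1)%N.
  have := dvdp_leq (monic_neq0 (char_poly_monic A)) (mxminpoly_dvd_char A).
  by rewrite size_char_poly (eqp_size minA) size_exp_XsubC.
have /dvdpP[r ->] : mxminpoly A %| ('X - 1%:P) ^+ n.+1.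
  by rewrite (eqp_dvdl _ minA) dvdp_exp2l.
by rewrite rmorphM /= mx_root_minpoly mulr0.
Qed.

(** * The bound on the cardinality *)

Lemma iter_affine (F : fieldType) n (A : 'M[F]_n.+1) (b x : 'cV[F]_n.+1)
    (f : 'cV[F]_n.+1 -> 'cV[F]_n.+1) m :
  (forall y, f y = A *m y + b) ->
  iter m f x = A ^+ m *m x + (\sum_(i < m) A ^+ i) *m b.
Proof.
move=> fE; elim: m => [|m IHm] /=; first by rewrite big_ord0 mul1mx mul0mx addr0.
rewrite fE IHm mulmxDr !mulmxA !mulmxE -exprS -addrA; congr (_ + _).
rewrite big_ord_recl mulmxDl mul1mx [LHS]addrC; congr (_ + _ *m _).
by rewrite mulr_sumr; apply: eq_bigr => i _; rewrite exprS.
Qed.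

Lemma affine_map_inj (F : finFieldType) n (f : 'cV[F]_n -> 'cV[F]_n) :
  affine_map f -> injective f.
Proof.
move=> [A [b [Aunit fE]]] x y; rewrite !fE => /addIr.
by move/(congr1 (mulmx (invmx A))); rewrite !mulKmx.
Qed.

Lemma card_finField_pchar (F : finFieldType) p :
  p \in [pchar F] -> [pchar F].-nat #|F|.
Proof.
move=> charFp; rewrite (eq_pnat _ (pcharf_eq charFp)).
by rewrite -cardsT; apply: pprimeChar_pgroup.
Qed.

Lemma transitive_affine_bound (F : finFieldType) p n
    (f : 'cV[F]_n.+1 -> 'cV[F]_n.+1) :
  p \in [pchar F] -> affine_map f -> transitive_map f ->
  (#|F| ^ n.+1 <= p * n.+1)%N.
Proof.
move=> charFp f_aff f_trans; have f_inj := affine_map_inj f_aff.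
have p_pr := pcharf_prime charFp.
have [A [b [_ fE]]] := f_aff.
have iterE m x := iter_affine x m fE.
have cardE : #|{: 'cV[F]_n.+1}| = (#|F| ^ n.+1)%N by rewrite card_mx muln1.
set N := (#|F| ^ n.+1)%N in cardE *.
have Nchar : [pchar F].-nat N by rewrite pnatX (card_finField_pchar charFp).
have AN1 : A ^+ N = 1.
  have fN x : A ^+ N *m x + (\sum_(i < N) A ^+ i) *m b = x.
    by rewrite -iterE -cardE transitive_map_iter_card.
  (* The value at [0] isolates the constant term, which is therefore zero. *)
  have c0 := fN 0; rewrite mulmx0 add0r in c0.
  apply/trmx_inj/row_matrixP => i; rewrite -!tr_col; congr trmx.
  by rewrite !colE; have := fN (delta_mx i 0); rewrite c0 addr0 mul1mx.
have A_unip : (A - 1) ^+ n.+1 = 0.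
  apply: (@unipotent_exp_dim _ _ _ N).
  have := exprB1_pchar ('X : {poly F}); move/(_ N).
  rewrite (eq_pnat _ (pchar_poly F)) => /(_ Nchar)/(congr1 (horner_mx A)).
  by rewrite rmorphXn !rmorphB rmorph1 rmorphXn /= horner_mx_X AN1 subrr.
have p_gt1 := prime_gt1 p_pr.
(* The dimension is [n.+1]; the power [p ^ s] must exceed it so that
   [(p ^ s).-1] reaches the nilpotency exponent of [A - 1]. *)
have /= /andP[lt_n le_n] := up_log_bounds p_gt1 (isT : (1 < n.+2)%N).
set s := up_log p n.+2 in lt_n le_n.
have ps_gt0 : (0 < p ^ s)%N by rewrite expn_gt0 prime_gt0.
have pschar : [pchar F].-nat (p ^ s)%N.
  by rewrite (eq_pnat _ (pcharf_eq charFp)) pnatX pnat_id.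
have back : iter (p ^ s) f 0 = 0.
  rewrite iterE mulmx0 add0r.
  have /(congr1 (horner_mx A)) := geometric_sum_pchar ps_gt0 pschar.
  rewrite rmorph_sum rmorphXn rmorphB rmorph1 /= horner_mx_X.
  under eq_bigr do rewrite rmorphXn /= horner_mx_X.
  move=> ->; have n_le : (n.+1 <= (p ^ s).-1)%N by rewrite -ltnS prednK.
  by rewrite -(subnK n_le) exprD A_unip mulr0 mul0mx.
have := transitive_map_card_le f_trans ps_gt0 back; rewrite cardE => N_le.
apply: leq_trans N_le _.
have s_gt0 : (0 < s)%N by case: (s) le_n.
by rewrite -(prednK s_gt0) expnS leq_mul2l -ltnS lt_n orbT.
Qed.

Lemma expn_le_pmul_cases p k n :
  prime p -> (0 < k)%N -> (0 < n)%N -> ((p ^ k) ^ n <= p * n)%N ->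
  (n = 1%N /\ prime (p ^ k)) \/ (n = 2 /\ p ^ k = 2)%N.
Proof.
move=> p_pr k_gt0; have p_gt1 := prime_gt1 p_pr.
have p_le : (p <= p ^ k)%N by rewrite -{1}(expn1 p) leq_pexp2l // ltnW.
case: n => [|[|[|n]]] // _ le_pn.
- left; split=> //; suff -> : (p ^ k)%N = p by [].
  by apply/eqP; rewrite eqn_leq p_le andbT -(expn1 (p ^ k)) -[leqRHS]muln1.
- right; split=> //; apply/eqP; rewrite eqn_leq (leq_trans p_gt1) // andbT.
  have := leq_trans le_pn (leq_mul p_le (leqnn 2)).
  by rewrite leq_pmul2l // (leq_trans _ p_le) // ltnW.
have := leq_trans le_pn (leq_mul p_le (leqnn n.+3)).
rewrite expnS leq_pmul2l ?(leq_trans _ p_le) ?(ltnW p_gt1) // leqNgt.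
case/negP; apply: (@leq_trans (2 ^ n.+2)); last first.
  by rewrite leq_exp2r // (leq_trans p_gt1).
elim: n {le_pn} => // n IHn; rewrite expnS mul2n -addnn.
by apply: leq_ltn_trans IHn _; rewrite -[ltnLHS]addn0 ltn_add2l expn_gt0.
Qed.

(** * Transitive affine maps in the exceptional cases *)

(** Translation by [1]: the [#|F|] multiples of [1] are distinct because the
    characteristic is [#|F|], so they fill the field. *)
Lemma exists_transitive_affine_line (F : finFieldType) :
  prime #|F| ->
  exists f : 'cV[F]_1 -> 'cV[F]_1, affine_map f /\ transitive_map f.
Proof.
move=> F_pr; have charF : #|F| \in [pchar F].
  by apply: (@card_finPcharP _ _ 1); rewrite ?expn1.
exists (fun x => x + const_mx 1); split.
  by exists 1%:M, (const_mx 1); split=> [|x]; rewrite ?unitmx1 ?mul1mx.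
pose g (i : 'I_#|F|) : F := i%:R.
have le_inj (i j : 'I_#|F|) : (i <= j)%N -> g i = g j -> i = j.
  move=> le_ij /eqP; rewrite eq_sym -subr_eq0 -natrB // -(dvdn_pcharf charF).
  move=> dvd_ji; apply/val_inj/eqP; rewrite /= eqn_leq le_ij -subn_eq0.
  apply: contraLR dvd_ji; rewrite -lt0n => ji_gt0; rewrite gtnNdvd //.
  exact: leq_ltn_trans (leq_subr _ _) (ltn_ord j).
have g_inj : injective g.
  move=> i j gij; have [le_ij|/ltnW le_ji] := leqP i j; first exact: le_inj.
  by apply/esym/le_inj.
move=> x y.
have g_onto : y 0 0 - x 0 0 \in codom g.
  by apply: (inj_card_onto g_inj); rewrite card_ord.
have [i gi] := codomP g_onto; exists i.
have iterE (m : nat) : iter m (fun z => z + const_mx 1) x 0 0 = x 0 0 + m%:R.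
  by elim: m => [|m IHm] /=; rewrite ?addr0 // !mxE IHm -addrA natr1.
apply/matrixP => a c; rewrite !ord1 iterE.
by rewrite -[i%:R]/(g i) -gi addrC subrK.
Qed.

Lemma card2_neq (F : finFieldType) (a b : F) :
  #|F| = 2%N -> a != b -> b = a + 1.
Proof.
move=> F2; rewrite eq_sym -subr_eq0 => ba_neq0.
suff : b - a = 1 by move/(canRL (subrK a)); rewrite addrC.
by apply: (mulfI ba_neq0); rewrite mulr1 -expr2 -{1}F2 expf_card.
Qed.

(** Writing [f (u, v) = (u + v, v + 1)], one has
    [f (f (u, v)) = (u + 1, v)], so one application of [f] adjusts the second
    coordinate and a further two adjust the first. *)
Lemma exists_transitive_affine_plane2 (F : finFieldType) :
  #|F| = 2%N ->
  exists f : 'cV[F]_2 -> 'cV[F]_2, affine_map f /\ transitive_map f.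
Proof.
move=> F2; have charF : 2 \in [pchar F] by apply: (@card_finPcharP _ _ 1).
pose A : 'M[F]_2 := \matrix_(i, j) (i <= j)%:R.
pose b : 'cV[F]_2 := delta_mx 1 0.
pose f x := A *m x + b.
have f0 x : f x 0 0 = x 0 0 + x 1 0.
  by rewrite !mxE big_ord_recl big_ord1 !mxE !mul1r addr0; congr (_ + x _ _);
     apply/val_inj.
have f1 x : f x 1 0 = x 1 0 + 1.
  by rewrite !mxE big_ord_recl big_ord1 !mxE mul0r add0r mul1r; congr (x _ _ + _);
     apply/val_inj.
have two0 : 1 + 1 = 0 :> F by apply: (pcharf0 charF).
have cV2P (x y : 'cV[F]_2) : x 0 0 = y 0 0 -> x 1 0 = y 1 0 -> x = y.
  move=> e0 e1; apply/matrixP => i j; rewrite ord1.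
  case: i => [[|[|//]]] i_lt; [move: e0|move: e1];
    by congr (x _ _ = y _ _); apply: val_inj.
exists f; split.
  exists A, b; split=> //.
  (* In characteristic 2 the transvection [A] is its own inverse. *)
  suff /mulmx1_unit[] : A *m A = 1%:M by [].
  apply/matrixP => i j; rewrite !mxE big_ord_recl big_ord1 !mxE.
  case: i => [[|[|//]]] i_lt; case: j => [[|[|//]]] j_lt /=;
    by rewrite !(mul0r, mul1r, mulr0, mulr1, addr0, add0r).
have fix1 (x y : 'cV[F]_2) : x 1 0 = y 1 0 -> exists i, y = iter i f x.
  have [e0|ne0] := eqVneq (x 0 0) (y 0 0) => e1.
    by exists 0%N; apply: cV2P.
  exists 2%N; apply: cV2P; rewrite /= ?f0 ?f1.
    rewrite (card2_neq F2 ne0) -addrA; congr (_ + _).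
    by rewrite addrA -mulr2n -mulr_natr (pcharf0 charF) mulr0 add0r.
  by rewrite -addrA two0 addr0.
move=> x y; have [|ne1] := eqVneq (x 1 0) (y 1 0); first exact: fix1.
have [i ->] : exists i, y = iter i f (f x).
  by apply: fix1; rewrite f1 -(card2_neq F2 ne1).
by exists i.+1; rewrite iterSr.
Qed.

Theorem theorem2p7 (q : nat) (F : finFieldType) (hF : #|F| = q)
    (n : nat) (hn : (1 <= n)%N) :
  (~ ((n = 1%N /\ prime q) \/ (n = 2%N /\ q = 2%N)) ->
    ~ exists f : 'cV[F]_n -> 'cV[F]_n, affine_map f /\ transitive_map f) /\
  ((n = 1%N /\ prime q) \/ (n = 2%N /\ q = 2%N) ->
    exists f : 'cV[F]_n -> 'cV[F]_n, affine_map f /\ transitive_map f).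
Proof.
split=> [not_exc [f [f_aff f_trans]] | [[n1 q_pr] | [n2 q2]]].
- case: n hn not_exc f f_aff f_trans => // n _ not_exc f f_aff f_trans.
  have [p p_pr charFp] := finPcharP F; apply: not_exc.
  have := transitive_affine_bound charFp f_aff f_trans.
  have := card_finField_pchar charFp.
  rewrite (eq_pnat _ (pcharf_eq charFp)) hF => /p_natP[k qE].
  have q_gt1 : (1 < q)%N by rewrite -hF finNzRing_gt1.
  rewrite qE; apply: expn_le_pmul_cases => //.
  by case: k qE => // qE; rewrite qE in q_gt1.
- by subst n; apply: exists_transitive_affine_line; rewrite hF.
- by subst n; apply: exists_transitive_affine_plane2; rewrite hF.
Qed.
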